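(* Consider a connected linear resistive electrical network whose nodes are split into $N_B\ge 1$ boundary nodes and $N_C\ge 1$ connection nodes, with Laplacian matrix $\mathcal{L}=\mathcal{D}G\mathcal{D}^T$ partitioned accordingly as $\mathcal{L}=\begin{bmatrix}\mathcal{L}_{BB}&\mathcal{L}_{BC}\\ \mathcal{L}_{CB}&\mathcal{L}_{CC}\end{bmatrix}$. Consider the linear map $\mathbb{R}^{N_C}\to\mathbb{R}^{N_B}$, $\bar{J}_C\mapsto-\bar{J}_B$, where $\bar{J}_B:=\mathcal{L}_{BC}\mathcal{L}_{CC}^{-1}\bar{J}_C$. Then this map has induced $1$-norm equal to $1$, i.e. $\sup_{\bar{J}_C\neq 0}\|\bar{J}_B\|_1/\|\bar{J}_C\|_1=1$. Moreover, it is dual to the map $\mathbb{R}^{N_B}\to\mathbb{R}^{N_C}$, $\psi_B^*\mapsto\psi_C^*:=-\mathcal{L}_{CC}^{-1}\mathcal{L}_{CB}\psi_B^*$, that is, $\bar{J}_C^T\psi_C^*=-\bar{J}_B^T\psi_B^*$ for all $\psi_B^*\in\mathbb{R}^{N_B}$ and $\bar{J}_C\in\mathbb{R}^{N_C}$, with corresponding $\psi_C^*$ and $\bar{J}_B$.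
   Context: A directed graph with $N$ nodes and $M$ edges (multiple edges allowed, no self-loops) is specified by its $N\times M$ incidence matrix $\mathcal{D}$: each column corresponds to an edge and has entry $1$ at the row of the tail node, $-1$ at the row of the head node, and $0$ elsewhere. The graph is connected if any node can be reached from any other node by a sequence of undirected edges. A linear resistive electrical network is such a graph together with a conductance $g_k>0$ for each edge $k=1,\dots,M$. Let $G=\mathrm{diag}(g_1,\dots,g_M)$. The Laplacian matrix is $\mathcal{L}=\mathcal{D}G\mathcal{D}^T$. The vector $\psi\in\mathbb{R}^N$ of nodal voltage potentials and the vector $J\in\mathbb{R}^N$ of nodal currents are related by $J=\mathcal{L}\psi$. The $N=N_B+N_C$ nodes are split into boundary nodes (index $B$) and connection nodes (index $C$), ordered so that boundary nodes come first, and correspondingly $\psi=\begin{bmatrix}\psi_B\\ \psi_C\end{bmatrix}$, $J=\begin{bmatrix}J_B\\ J_C\end{bmatrix}$, and $\mathcal{L}$ is partitioned into blocks. Since the graph is connected and there is at least one boundary node, $\mathcal{L}_{CC}$ is invertible. Short-circuit problem: with $\psi_B=0$ and prescribed connection-node currents $J_C=\bar{J}_C$, the connection-node potentials are $\bar{\psi}_C=\mathcal{L}_{CC}^{-1}\bar{J}_C$ and the boundary currents are $\bar{J}_B=\mathcal{L}_{BC}\mathcal{L}_{CC}^{-1}\bar{J}_C$. Open-circuit (Kirchhoff) problem: with $\psi_B=\psi_B^*$ prescribed and $J_C=0$, the connection-node potentials are $\psi_C^*=-\mathcal{L}_{CC}^{-1}\mathcal{L}_{CB}\psi_B^*$. The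 $1$-norm is $\|z\|_1=\sum_j|z_j|$. *)

(* Defs.v *)
From mathcomp Require Import all_boot all_order all_algebra.
From mathcomp Require Import classical_sets reals.

Set Implicit Arguments.
Unset Strict Implicit.
Unset Printing Implicit Defensive.

Import Order.TTheory GRing.Theory Num.Theory.
Local Open Scope ring_scope.
Local Open Scope classical_set_scope.

Record digraph (n m : nat) := Digraph {
  tail : 'I_m -> 'I_n;
  head : 'I_m -> 'I_n;
  no_self_loop : forall k, tail k != head k
}.

Definition adjacent (n m : nat) (D : digraph n m) : rel 'I_n :=
  fun i j => [exists k, ((tail D k == i) && (head D k == j))
                     || ((tail D k == j) && (head D k == i))].

Definition graph_connected (n m : nat) (D : digraph n m) : Prop :=
  forall i j : 'I_n, connect (adjacent D) i j.

Definition incidence (R : realType) (n m : nat) (D : digraph n m) :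
    'M[R]_(n, m) :=
  \matrix_(i < n, k < m)
    (if i == tail D k then 1 else if i == head D k then -1 else 0).

Record network (R : realType) (n m : nat) := Network {
  graph : digraph n m;
  conductance : 'rV[R]_m;
  conductance_gt0 : forall k, 0 < conductance 0 k
}.

Definition laplacian (R : realType) (n m : nat) (W : network R n m) :
    'M[R]_n :=
  incidence R (graph W) *m diag_mx (conductance W) *m (incidence R (graph W))^T.

(* The first NB nodes are the boundary nodes and the last NC the connection
   nodes, so that ursubmx, dlsubmx and drsubmx are the blocks BC, CB and CC.
   The block CC is invertible when the graph is connected and NB > 0; when it
   is singular, invmx returns its argument unchanged. *)

Definition short_circuit_JB (R : realType) (NB NC m : nat)
    (W : network R (NB + NC) m) (JC : 'cV[R]_NC) : 'cV[R]_NB :=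
  ursubmx (laplacian W) *m invmx (drsubmx (laplacian W)) *m JC.

Definition open_circuit_psiC (R : realType) (NB NC m : nat)
    (W : network R (NB + NC) m) (psiB : 'cV[R]_NB) : 'cV[R]_NC :=
  - (invmx (drsubmx (laplacian W)) *m dlsubmx (laplacian W) *m psiB).

Definition norm1 (R : realType) (n : nat) (z : 'cV[R]_n) : R :=
  \sum_(j < n) `|z j 0|.

(* [sup] is 0 on sets that are empty or unbounded above, so a positive value
   of [induced_norm1 f] is a genuine least upper bound. *)
Definition induced_norm1 (R : realType) (p q : nat)
    (f : 'cV[R]_p -> 'cV[R]_q) : R :=
  sup [set norm1 (f z) / norm1 z | z in [set z | z != 0]].

(* Main.v *)
(** Summing the rows of the Laplacian gives zero, so every column of
    [P = - L_BC L_CC^-1] sums to 1; since [P] is moreover entrywise nonnegative,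
    it contracts the 1-norm, with equality on nonnegative vectors.
    Nonnegativity is the discrete minimum principle: if [v] vanishes on the
    boundary and [L v >= 0] on the connection nodes, then pairing [L v] with the
    negative part [w] of [v] gives [0 <= w^T L v <= - w^T L w], so [w] is
    constant along edges, hence zero by connectedness.  Applied to [v] and [- v]
    it also shows that [L_CC] is invertible.  Duality is the symmetry of the
    Laplacian. *)
Require Import Defs.
From mathcomp Require Import all_boot all_order all_algebra.
From mathcomp Require Import classical_sets reals.
From mathcomp Require Import lra.

Import Order.TTheory GRing.Theory Num.Theory.
Local Open Scope ring_scope.

(** * Energy form and minimum principle of the Laplacian *)

Section Laplacian.
Context {R : realType} {n m : nat} (W : network R n m).

Local Notation L := (laplacian W).
Local Notation t := (tail (graph W)).
Local Notation h := (Defs.head (graph W)).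
Local Notation g := (conductance W).

Lemma tr_incidence_mul (u : 'cV[R]_n) k :
  ((incidence R (graph W))^T *m u) k 0 = u (t k) 0 - u (h k) 0.
Proof.
have nth := no_self_loop (graph W) k.
rewrite mxE (bigD1 (t k)) //= (bigD1 (h k)) /=; last by rewrite eq_sym.
rewrite !mxE !eqxx eq_sym (negPf nth) big1 ?addr0 ?mul1r ?mulN1r // => i.
by case/andP=> /negPf it /negPf ih; rewrite !mxE it ih mul0r.
Qed.

(** The factorization of [L] through the edges gives its Dirichlet form, whose sign can be studied
    edge by edge. *)
Lemma laplacian_form (u v : 'cV[R]_n) :
  (u^T *m (L *m v)) 0 0 =
  \sum_k g 0 k * ((u (t k) 0 - u (h k) 0) * (v (t k) 0 - v (h k) 0)).
Proof.
rewrite /laplacian -!mulmxA mulmxA mulmxA mxE; apply: eq_bigr => k _.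
rewrite tr_incidence_mul mul_mx_diag mxE -[_ *m incidence _ _]trmxK trmx_mul.
by rewrite trmxK mxE tr_incidence_mul mulrCA mulrA.
Qed.

Lemma laplacian_sym : L^T = L.
Proof. by rewrite /laplacian !trmx_mul trmxK tr_diag_mx mulmxA. Qed.

Lemma laplacian_mul_const (c : R) : L *m (const_mx c : 'cV_n) = 0.
Proof.
rewrite /laplacian -mulmxA (_ : _^T *m _ = 0) ?mulmx0 //.
by apply/matrixP=> k j; rewrite ord1 tr_incidence_mul !mxE subrr.
Qed.

(** An incidence column has a single 1 and a single -1, so at two distinct nodes its entries have
    product 0 or -1. *)
Lemma laplacian_offdiag_le0 i j : i != j -> L i j <= 0.
Proof.
move=> nij; rewrite mxE; apply: sumr_le0 => k _.
rewrite mul_mx_diag !mxE mulrAC; apply: mulr_le0_ge0; last first.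
  exact/ltW/conductance_gt0.
case: (eqVneq i (t k)) nij => [->|_] nij.
  by rewrite eq_sym (negPf nij) mul1r; case: ifP => // _; rewrite lerN10.
case: (eqVneq i (h k)) nij => [->|_] nij; last by rewrite mul0r.
rewrite [j == h k]eq_sym (negPf nij) mulN1r.
by case: ifP => // _; rewrite ?oppr0 ?lerN10.
Qed.

Hypothesis conn : graph_connected (graph W).

Lemma constant_of_edges (w : 'I_n -> R) :
  (forall k, w (t k) = w (h k)) -> forall i j, w i = w j.
Proof.
move=> we i j; case/connectP: (conn i j) => p + ->.
elim: p i => //= x p IH i /andP[/existsP[k ik] /IH <-].
by case/orP: ik => /andP[/eqP<- /eqP<-]; rewrite we.
Qed.

(* With [w = max (- v) 0] each edge satisfies [dw * dv <= - dw ^+ 2]. *)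
Lemma laplacian_minimum_principle (v : 'cV[R]_n) (i0 : 'I_n) :
  0 <= v i0 0 -> (forall i, 0 <= v i 0 \/ 0 <= (L *m v) i 0) ->
  forall i, 0 <= v i 0.
Proof.
move=> v0 hv.
pose w : 'cV[R]_n := \col_i Num.max (- v i 0) 0.
have wE i : w i 0 = Num.max (- v i 0) 0 by rewrite mxE.
(* At each node either [v] is nonnegative and [w] vanishes, or both factors are nonnegative. *)
have form_ge0 : 0 <= (w^T *m (L *m v)) 0 0.
  rewrite mxE; apply: sumr_ge0 => i _; rewrite mxE wE.
  case: (hv i) => [vi|Lvi]; last by rewrite mulr_ge0 // le_max lexx orbT.
  by rewrite (max_idPr _) ?oppr_le0 // mul0r.
have edge_le k : (w (t k) 0 - w (h k) 0) * (v (t k) 0 - v (h k) 0) <=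
    - (w (t k) 0 - w (h k) 0) ^+ 2.
  by rewrite !wE; case: (leP (- v (t k) 0) 0); case: (leP (- v (h k) 0) 0); nra.
have w_edge k : w (t k) 0 = w (h k) 0.
  have term_le0 l :
      g 0 l * ((w (t l) 0 - w (h l) 0) * (v (t l) 0 - v (h l) 0)) <= 0.
    rewrite pmulr_rle0 ?conductance_gt0 //.
    by apply: le_trans (edge_le l) _; rewrite oppr_le0 sqr_ge0.
  (* Nonpositive terms with a nonnegative sum: the term of [k] must be nonnegative, and [edge_le]
     then kills the square. *)
  move: form_ge0; rewrite laplacian_form (bigD1 k) //= => sum_ge0.
  have rest : \sum_(l < m | l != k)
      g 0 l * ((w (t l) 0 - w (h l) 0) * (v (t l) 0 - v (h l) 0)) <= 0.
    by apply: sumr_le0 => l _; exact: term_le0.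
  have : 0 <= g 0 k * ((w (t k) 0 - w (h k) 0) * (v (t k) 0 - v (h k) 0)).
    by lra.
  rewrite pmulr_rge0 ?conductance_gt0 // => /le_trans/(_ (edge_le k)).
  rewrite oppr_ge0 => sq_le0; apply/eqP.
  by rewrite -subr_eq0 -sqrf_eq0 eq_le sq_le0 sqr_ge0.
(* The constant is zero because [w] vanishes at [i0]. *)
move=> i; have := constant_of_edges (fun i => w i 0) w_edge i i0.
rewrite !wE [RHS](max_idPr _) ?oppr_le0 // => wi0.
by rewrite -oppr_le0 -wi0 le_max lexx.
Qed.

End Laplacian.

Lemma unitmx_of_ker0 (F : fieldType) (n : nat) (A : 'M[F]_n) :
  (forall v : 'cV_n, A *m v = 0 -> v = 0) -> A \in unitmx.
Proof.
move=> ker0; rewrite -unitmx_tr -row_free_unit -kermx_eq0.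
apply/eqP/row_matrixP=> i; rewrite row0; apply: trmx_inj; rewrite trmx0.
apply: ker0; apply: trmx_inj.
by rewrite trmx_mul trmxK trmx0 -row_mul mulmx_ker row0.
Qed.

(** * Blocks of the Laplacian and the short-circuit map *)

Section Network.
Context {R : realType} {NB NC m : nat} (W : network R (NB + NC) m).

Local Notation L := (laplacian W).
Local Notation LCC := (drsubmx L).
Local Notation LBC := (ursubmx L).

Lemma open_short_dual (psiB : 'cV[R]_NB) (JC : 'cV[R]_NC) :
  JC^T *m open_circuit_psiC W psiB = - ((short_circuit_JB W JC)^T *m psiB).
Proof.
rewrite /open_circuit_psiC /short_circuit_JB mulmxN !trmx_mul trmx_inv.
by rewrite trmx_drsub trmx_ursub laplacian_sym !mulmxA.
Qed.

Hypotheses (hB : (0 < NB)%N) (conn : graph_connected (graph W)).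

(** Extend [v] by zero to the boundary: [LCC *m v] is the connection part of the Laplacian of the
    extension, and any boundary node serves as [i0]. *)
Lemma LCC_minimum_principle (v : 'cV[R]_NC) :
  (forall i, 0 <= (LCC *m v) i 0) -> forall i, 0 <= v i 0.
Proof.
move=> hv i.
have := laplacian_minimum_principle W conn (col_mx 0 v)
  (lshift NC (Ordinal hB)).
rewrite col_mxEu mxE => /(_ (lexx _)) minP.
rewrite -(col_mxEd (0 : 'cV_NB)); apply: minP => k.
case: (split_ordP k) => [b ->|c ->]; first by left; rewrite col_mxEu mxE.
right; rewrite -[L]submxK mul_block_col !mulmx0 !add0r col_mxEd.
exact: hv.
Qed.

Lemma LCC_unit : LCC \in unitmx.
Proof.
apply: unitmx_of_ker0 => v Lv0; apply/colP=> i; apply/eqP.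
rewrite [X in _ == X]mxE eq_le; apply/andP; split; last first.
  by apply: LCC_minimum_principle => j; rewrite Lv0 mxE.
have := LCC_minimum_principle (- v) _ i.
rewrite mulmxN Lv0 oppr0 mxE oppr_ge0; apply=> j.
by rewrite mxE.
Qed.

Lemma invmx_LCC_ge0 i j : 0 <= invmx LCC i j.
Proof.
(* [LCC] sends this column to a unit vector, which is nonnegative. *)
have := LCC_minimum_principle (col j (invmx LCC)) _ i.
rewrite [X in _ <= X]mxE; apply=> k.
by rewrite colE mulmxA (mulmxV LCC_unit) mul1mx mxE ler0n.
Qed.

Local Notation P := (- (LBC *m invmx LCC)).

Lemma short_circuit_ge0 i j : 0 <= P i j.
Proof.
rewrite -mulNmx mxE; apply: sumr_ge0 => k _.
rewrite mulr_ge0 ?invmx_LCC_ge0 // mxE oppr_ge0.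
rewrite -(block_mxEur (ulsubmx L) _ (dlsubmx L) LCC) submxK.
by apply: laplacian_offdiag_le0; rewrite eq_lrshift.
Qed.

Lemma short_circuit_col_sum j : \sum_i P i j = 1.
Proof.
(* These are the connection columns of the identity saying that the all-ones row annihilates [L]. *)
have rowL : (const_mx 1 : 'rV_NB) *m LBC + (const_mx 1 : 'rV_NC) *m LCC = 0.
  have := congr1 trmx (laplacian_mul_const W 1).
  rewrite trmx_mul laplacian_sym trmx0 trmx_const -row_mx_const -[L]submxK.
  by rewrite mul_row_block -row_mx0 => /eq_row_mx[_ <-]; rewrite submxK.
have rowP : (const_mx 1 : 'rV_NB) *m P = const_mx 1.
  by rewrite mulmxN mulmxA -mulNmx (addr0_eq rowL) mulmxK ?LCC_unit.
have := congr1 (fun A : 'rV_NC => A 0 j) rowP.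
by rewrite !mxE => <-; apply: eq_bigr => i _; rewrite [in RHS]mxE mul1r.
Qed.

End Network.

(** * The 1-norm of column-stochastic matrices *)

Section Norm1.
Context {R : realType} {p q : nat} (A : 'M[R]_(q, p)).
Hypothesis A_ge0 : forall i j, 0 <= A i j.
Hypothesis A_sum : forall j, \sum_i A i j = 1.

Lemma norm1_stochastic_le (z : 'cV[R]_p) : norm1 (A *m z) <= norm1 z.
Proof.
rewrite /norm1 -[leRHS](eq_bigr _ (fun j _ => mul1r _)).
(* Weighting each [z j 0] by its column sum 1 reduces the claim to the triangle inequality in each
   row. *)
under [leRHS]eq_bigr => j _ do rewrite -(A_sum j) mulr_suml.
rewrite exchange_big; apply: ler_sum => i _; rewrite mxE.
apply: le_trans (ler_norm_sum _ _ _) _; apply: ler_sum => j _.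
by rewrite normrM ger0_norm.
Qed.

Lemma norm1_stochastic_eq (z : 'cV[R]_p) :
  (forall j, 0 <= z j 0) -> norm1 (A *m z) = norm1 z.
Proof.
move=> z_ge0; rewrite /norm1.
under [RHS]eq_bigr => j _ do
  rewrite ger0_norm // -[z j 0]mul1r -(A_sum j) mulr_suml.
rewrite exchange_big; apply: eq_bigr => i _.
by rewrite mxE ger0_norm //; apply: sumr_ge0 => j _; rewrite mulr_ge0.
Qed.

Lemma norm1_gt0 (z : 'cV[R]_p) : z != 0 -> 0 < norm1 z.
Proof.
move=> z0; rewrite lt0r sumr_ge0 // andbT; apply: contra_neq z0 => /eqP.
rewrite psumr_eq0 // => /allP z0; apply/colP=> j; rewrite mxE.
by apply/eqP; rewrite -normr_eq0; apply: z0 (mem_index_enum j).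
Qed.

Lemma induced_norm1_stochastic : (0 < p)%N -> induced_norm1 (mulmx A) = 1.
Proof.
move=> p_gt0; rewrite /induced_norm1; set S := (X in sup X).
have ub1 : ubound S 1.
  move=> _ [z z0 <-]; rewrite ler_pdivrMr ?mul1r ?norm1_gt0 //.
  exact: norm1_stochastic_le.
(* The bound is attained at the all-ones vector, which is nonzero since [p] is positive. *)
have S1 : S 1.
  have one_neq0 : (const_mx 1 : 'cV[R]_p) != 0.
    by apply/eqP=> /colP/(_ (Ordinal p_gt0))/eqP; rewrite !mxE oner_eq0.
  exists (const_mx 1) => //; rewrite norm1_stochastic_eq => [|j]; last first.
    by rewrite mxE.
  by rewrite divff // gt_eqF // norm1_gt0.
apply/eqP; rewrite eq_le ge_sup ?ub_le_sup //; first by exists 1.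
by exists 1.
Qed.

End Norm1.

Theorem proposition4p4 (R : realType) (NB NC M : nat)
    (W : network R (NB + NC) M)
    (hB : (1 <= NB)%N) (hC : (1 <= NC)%N)
    (hW : graph_connected (graph W)) :
  induced_norm1 (fun JC : 'cV[R]_NC => - short_circuit_JB W JC) = 1 /\
  (forall (psiB : 'cV[R]_NB) (JC : 'cV[R]_NC),
     JC^T *m open_circuit_psiC W psiB = - ((short_circuit_JB W JC)^T *m psiB)).
Proof.
split; last exact: open_short_dual.
rewrite -(induced_norm1_stochastic _ (short_circuit_ge0 W hB hW)
  (short_circuit_col_sum W hB hW) hC) /induced_norm1.
congr sup; apply: eq_imagel => JC _ /=.
by rewrite mulNmx.
Qed.
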